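(* Let $A$ be an $n\times n$ (complex) unitary matrix and let $M:=\max_{i,j}|A(ij)|$ be the maximal absolute value of its entries. Then $$|\mathrm{supp}(f)|\cdot|\mathrm{supp}(Af)|\ge\frac1{M^2}\qquad\text{for all } f\in\mathbb C^n\setminus\{0\}.$$
   Context: $\mathrm{supp}(f)=\{k: f(k)\ne0\}$ for a vector $f$, and $|\cdot|$ of a set denotes its cardinality. *)

(* Defs.v *)
From mathcomp Require Import all_boot all_order all_algebra.
From mathcomp Require Import reals.
From mathcomp.real_closed Require Import complex.

Set Implicit Arguments.
Unset Strict Implicit.
Unset Printing Implicit Defensive.

Import Order.TTheory GRing.Theory Num.Theory.
Local Open Scope ring_scope.
Local Open Scope complex_scope.

Definition supp (R : realType) (n : nat) (f : 'cV[R[i]]_n) : {set 'I_n} :=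
  [set k | f k 0 != 0].

(* [Normc.normc z] is the complex modulus as an element of [R].  The moduli
   are nonnegative, so starting the iterated maximum at 0 does not change it
   for n > 0. *)
Definition maxnorm (R : realType) (n : nat) (A : 'M[R[i]]_n) : R :=
  \big[Num.max/0]_(i < n) \big[Num.max/0]_(j < n) Normc.normc (A i j).

(* Main.v *)
(** Unitarity gives [||Af|| = ||f||].  Every entry of [Af] has modulus at most
    [M * ||f||_1], and [||f||_1 ^ 2 <= |supp f| * ||f|| ^ 2] by Cauchy-Schwarz,
    so [||f|| ^ 2 = ||Af|| ^ 2 <= |supp (Af)| * M ^ 2 * |supp f| * ||f|| ^ 2]. *)
Require Import Defs.
From mathcomp Require Import all_boot all_order all_algebra.
From mathcomp Require Import reals.
From mathcomp.real_closed Require Import complex.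
From mathcomp Require Import ring lra.

Set Implicit Arguments.
Unset Strict Implicit.
Unset Printing Implicit Defensive.

Import Order.TTheory GRing.Theory Num.Theory.
Local Open Scope ring_scope.
Local Open Scope complex_scope.

(** Expanding the square gives the double sum of [a i * a j]. Each product is at most
    [(a i ^+ 2 + a j ^+ 2) / 2], and these means sum over all pairs to the right-hand side. *)
Lemma sqr_sum_le_card (R : realFieldType) (I : finType) (D : {set I})
    (a : I -> R) :
  (\sum_(i in D) a i) ^+ 2 <= #|D|%:R * \sum_(i in D) a i ^+ 2.
Proof.
rewrite expr2 big_distrlr /=.
have -> : #|D|%:R * \sum_(i in D) a i ^+ 2 =
    \sum_(i in D) \sum_(j in D) (a i ^+ 2 + a j ^+ 2) / 2.
  under [RHS]eq_bigr => i _ do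
    rewrite -mulr_suml big_split /= sumr_const -[_ *+ #|D|]mulr_natl.
  rewrite -mulr_suml big_split /= sumr_const -mulr_sumr -mulr_natl.
  by field.
apply: ler_sum => i _; apply: ler_sum => j _.
have := sqr_ge0 (a i - a j); nra.
Qed.

(** The squared norm of [g] is the single entry of $g^* g$, and $(Af)^*(Af) = f^* (A^* A) f$. *)
Lemma unitary_sum_sqr_norm (C : numClosedFieldType) (n : nat) (A : 'M[C]_n)
    (f : 'cV[C]_n) :
  A \is unitarymx ->
  \sum_i `|(A *m f) i 0| ^+ 2 = \sum_i `|f i 0| ^+ 2.
Proof.
(* [unitarymx] provides $A A^* = 1$; for a square matrix this yields $A^* A = 1$. *)
move=> /unitarymxP /mulmx1C AA.
have sqE (g : 'cV[C]_n) :
    \sum_i `|g i 0| ^+ 2 = ((map_mx Num.conj g^T) *m g) 0 0.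
  by rewrite mxE; apply: eq_bigr => i _; rewrite !mxE normCK mulrC.
by rewrite !sqE trmx_mul map_mxM mulmxA -(mulmxA _ _ A) AA mulmx1.
Qed.

Lemma normc_le_maxnorm (R : realType) (n : nat) (A : 'M[R[i]]_n) (i j : 'I_n) :
  Normc.normc (A i j) <= maxnorm A.
Proof.
apply: le_trans (le_bigmax _ _ i).
exact: le_trans (le_bigmax _ (fun j => Normc.normc (A i j)) j).
Qed.

Theorem theorem5p6 (R : realType) (n : nat) (A : 'M[R[i]]_n)
    (hA : A \is unitarymx) (f : 'cV[R[i]]_n) (hf : f != 0) :
  1 / maxnorm A ^+ 2 <= (#|supp f| * #|supp (A *m f)|)%:R :> R.
Proof.
pose nc := @Normc.normc R.
have normE (z : R[i]) : `|z| = (nc z)%:C by [].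
have nc_ge0 (z : R[i]) : 0 <= nc z by rewrite -ler0c -normE.
have nc0 : nc 0 = 0 by apply: complexI; rewrite -normE normr0.
set g := A *m f; set M := maxnorm A.
pose E := \sum_(k in supp f) nc (f k 0) ^+ 2.
pose S := \sum_(k in supp f) nc (f k 0).
have suppE (h : 'cV[R[i]]_n) :
    \sum_(k in supp h) nc (h k 0) ^+ 2 = \sum_k nc (h k 0) ^+ 2.
  rewrite [RHS](bigID (mem (supp h))) /= [X in _ + X]big1 ?addr0 // => k.
  by rewrite inE negbK => /eqP ->; rewrite nc0 expr0n.
(* The embedding of the reals into [R[i]] is injective, so the identity may be checked on complex
   norms. *)
have parseval : \sum_(i in supp g) nc (g i 0) ^+ 2 = E.
  rewrite /E !suppE; apply: complexI; rewrite !rmorph_sum /=.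
  under eq_bigr => i _ do rewrite rmorphXn /= -normE.
  under [RHS]eq_bigr => i _ do rewrite rmorphXn /= -normE.
  exact: unitary_sum_sqr_norm.
have g_le i : nc (g i 0) <= M * S.
  (* Only indices in [supp f] contribute to the entry of [A *m f], so the triangle inequality gives
     a sum over [supp f]. *)
  rewrite -lecR -normE mxE (bigID (mem (supp f))) /= [X in _ + X]big1 ?addr0.
    rewrite (le_trans (ler_norm_sum _ _ _)) // mulr_sumr rmorph_sum /=.
    apply: ler_sum => k _; rewrite normrM !normE -rmorphM lecR.
    by rewrite ler_wpM2r // normc_le_maxnorm.
  by move=> k; rewrite inE negbK => /eqP ->; rewrite mulr0.
have E_gt0 : 0 < E.
  have [k fk] : exists k, f k 0 != 0 by apply/cV0Pn.
  rewrite /E (bigD1 k) ?inE //=; apply: ltr_pwDl; last first.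
    by apply: sumr_ge0 => j _; apply: sqr_ge0.
  by rewrite exprn_gt0 // -ltcR -normE normr_gt0.
have E_le : E <= #|supp g|%:R * (M * S) ^+ 2.
  rewrite -parseval mulr_natl -sumr_const; apply: ler_sum => i _.
  (* Squaring needs [0 <= M * S], which follows from [g_le i] as moduli are nonnegative. *)
  by rewrite lerXn2r ?nnegrE // (le_trans _ (g_le i)).
have S_le : S ^+ 2 <= #|supp f|%:R * E := sqr_sum_le_card _ _.
(* Since the inverse of 0 is 0, the left-hand side vanishes when [M = 0]. *)
have [->|M0] := eqVneq M 0; first by rewrite expr0n /= invr0 mulr0 ler0n.
have M2_gt0 : 0 < M ^+ 2 by rewrite exprn_even_gt0.
(* Clearing [M ^+ 2] and multiplying by [E > 0] leaves a bound on [E], obtained by chaining [E_le]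
   with [S_le]. *)
rewrite ler_pdivrMr // -(ler_pM2r E_gt0) mul1r (le_trans E_le) //.
rewrite natrM exprMn.
have -> : #|supp f|%:R * #|supp g|%:R * M ^+ 2 * E =
  #|supp g|%:R * (M ^+ 2 * (#|supp f|%:R * E)) by ring.
by rewrite ler_wpM2l // ler_wpM2l // ltW.
Qed.
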